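(* Suppose $|a|_p>\alpha=\beta$. For $k=0,1,2,\dots$ let $\mathcal P_k=\{x\in\mathbb C_p: f^k(x)\in\{\hat x_1,\hat x_2\}\}$. Then: 1. $\mathcal P_k\ne\emptyset$ for every $k=0,1,2,\dots$. 2. $\mathcal P_k\subset S_{r_k}(0)$, where $r_k=\alpha\cdot\left(\dfrac{\alpha}{|a|_p}\right)^{\frac{2^k-1}{2^k}}$, $k=0,1,2,\dots$.
   Context: $p$ is a prime and $\mathbb C_p$ is the field of complex $p$-adic numbers with norm $|\cdot|_p$. Let $a,b,d\in\mathbb C_p$ with $ab\neq0$, $a\ne d$, and $$f(x)=\frac{ax^2+bx}{x^2+dx+b},\qquad x\in\mathbb C_p\setminus\{\hat x_1,\hat x_2\},$$ where $\hat x_1,\hat x_2\in\mathbb C_p$ are the two (possibly equal) roots of $x^2+dx+b$. Put $\alpha=|\hat x_1|_p$, $\beta=|\hat x_2|_p$, labelled so that $\alpha\le\beta$. Standing assumption: $f$ has the two distinct fixed points $x_1=0$ and $x_2=a-d$ (in particular $x_2\notin\{\hat x_1,\hat x_2\}$, i.e. $b+a(a-d)\neq0$). $f^k$ is the $k$-th iterate of $f$ ($f^0=\mathrm{id}$), with $f^k(x)$ considered only when all intermediate values are defined. $S_r(0)=\{x\in\mathbb C_p:|x|_p=r\}$. *)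

(* Defs.v *)
From HB Require Import structures.
From mathcomp Require Import all_boot all_order all_algebra.
From mathcomp Require Import all_classical all_reals all_analysis.

Set Implicit Arguments.
Unset Strict Implicit.
Unset Printing Implicit Defensive.

Import Order.TTheory GRing.Theory Num.Theory.
Local Open Scope classical_set_scope.
Local Open Scope ring_scope.

Section ValuedField.
Variables (R : realType) (K : fieldType) (nrm : K -> R).

(* Non-archimedean multiplicative norms with |p| = 1/p.  For prime p such a
   norm restricts to the usual p-adic norm on the rationals. *)
Definition is_padic_norm (p : nat) : Prop :=
  [/\ forall x, 0 <= nrm x,
      forall x, (nrm x = 0) <-> (x = 0),
      forall x y, nrm (x * y) = nrm x * nrm y,
      forall x y, nrm (x + y) <= Num.max (nrm x) (nrm y) &
      nrm p%:R = p%:R^-1].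

Definition norm_closure (A : set K) : set K :=
  [set x | forall e : R, 0 < e -> exists2 y, A y & nrm (x - y) < e].

Definition norm_complete : Prop :=
  forall u : nat -> K,
    (forall e : R, 0 < e ->
       exists N, forall m n, (N <= m)%N -> (N <= n)%N -> nrm (u m - u n) < e) ->
    exists l, forall e : R, 0 < e ->
      exists N, forall n, (N <= n)%N -> nrm (u n - l) < e.

(* In a complete field with a p-adic norm, the closure of the rationals is a
   copy of Q_p. *)
Definition Qp_in : set K := norm_closure (range (ratr : rat -> K)).

Definition algebraic_over_set (A : set K) : set K :=
  [set x | exists P : {poly K}, [/\ P != 0, forall i, A P`_i & root P x]].

End ValuedField.

(* C_p, the completion of an algebraic closure of Q_p: an algebraically closed
   field, complete for a norm extending the p-adic one, in which the algebraic
   closure of Q_p is dense.  These properties determine C_p up to isometric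
   isomorphism. *)
Record complex_padic (R : realType) (p : nat) := ComplexPadic {
  Cp_field :> closedFieldType;
  pnorm : Cp_field -> R;
  pnorm_padic : is_padic_norm pnorm p;
  pnorm_complete : norm_complete pnorm;
  pnorm_dense :
    norm_closure pnorm (algebraic_over_set (Qp_in pnorm)) = [set: Cp_field]
}.

Section Dynamics.
Variable K : fieldType.

(* None stands for "undefined": f has no value at the roots of x^2 + d x + b. *)
Definition ratmap (a b d : K) (x : K) : option K :=
  if x ^+ 2 + d * x + b == 0 then None
  else Some ((a * x ^+ 2 + b * x) / (x ^+ 2 + d * x + b)).

Definition ratmap_iter (a b d : K) (k : nat) (x : K) : option K :=
  iter k (obind (ratmap a b d)) (Some x).

Definition prepoles (a b d xh1 xh2 : K) (k : nat) : set K :=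
  [set x | ratmap_iter a b d k x = Some xh1 \/
           ratmap_iter a b d k x = Some xh2].

End Dynamics.

Definition psphere0 (R : realType) (p : nat) (Cp : complex_padic R p) (r : R) :
  set Cp := [set x | pnorm x = r].
Arguments psphere0 {R p} Cp r.

(* Main.v *)
(** Put [A = |a|].  Since [alpha = beta < A], one has [|b| = alpha^2] and
    [|d| <= alpha].  Then [|f(x)| <= |x|] for [|x| <= alpha^2 / A],
    [|f(x)| = A |x|^2 / alpha^2] for [alpha^2 / A < |x| < alpha], and
    [|f(x)| >= A] for [|x| >= alpha].  So a preimage [x] of a point [y] with
    [alpha^2 / A < |y| <= alpha] satisfies [A |x|^2 = alpha^2 |y|], which is the
    recurrence satisfied by the radii [r_k].  A preimage exists because
    [f(x) = y] clears to a genuine quadratic equation ([|y| < |a|]), whose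
    solutions are not poles: the numerator and the denominator of [f] are
    coprime when [b + a (a - d) <> 0]. *)

Require Import Defs.
From HB Require Import structures.
From mathcomp Require Import all_boot all_order all_algebra.
From mathcomp Require Import all_classical all_reals all_analysis.
From mathcomp Require Import ring.

Set Implicit Arguments.
Unset Strict Implicit.
Unset Printing Implicit Defensive.

Import Order.TTheory GRing.Theory Num.Theory.
Local Open Scope classical_set_scope.
Local Open Scope ring_scope.

(** * Ultrametric norms *)

Section PadicNorm.
Variables (R : realType) (K : fieldType) (nrm : K -> R) (p : nat).
Hypothesis nrm_padic : is_padic_norm nrm p.

Lemma padic_norm_ge0 x : 0 <= nrm x.
Proof. by case: nrm_padic. Qed.

Lemma padic_normM x y : nrm (x * y) = nrm x * nrm y.
Proof. by case: nrm_padic. Qed.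

Lemma padic_norm_eq0 x : (nrm x == 0) = (x == 0).
Proof. by case: nrm_padic => _ n0 _ _ _; apply/eqP/eqP => /n0. Qed.

Lemma padic_norm_gt0 x : (0 < nrm x) = (x != 0).
Proof. by rewrite lt0r padic_norm_eq0 padic_norm_ge0 andbT. Qed.

Lemma padic_norm1 : nrm 1 = 1.
Proof.
have n1 : nrm 1 != 0 by rewrite padic_norm_eq0 oner_neq0.
by apply: (mulfI n1); rewrite -padic_normM !mulr1.
Qed.

Lemma padic_normX x n : nrm (x ^+ n) = nrm x ^+ n.
Proof.
by elim: n => [|n IHn]; rewrite ?expr0 ?padic_norm1 // !exprS padic_normM IHn.
Qed.

Lemma padic_normN x : nrm (- x) = nrm x.
Proof.
(* Both norms are nonnegative, so comparing their squares suffices. *)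
apply/eqP; rewrite -(@eqrXn2 _ 2) ?padic_norm_ge0 //.
by rewrite -!padic_normX sqrrN.
Qed.

Lemma padic_normD_le x y r : nrm x <= r -> nrm y <= r -> nrm (x + y) <= r.
Proof.
move=> xr yr; case: nrm_padic => _ _ _ nD _.
by apply: (le_trans (nD x y)); rewrite ge_max xr yr.
Qed.

Lemma padic_normD_lt x y r : nrm x < r -> nrm y < r -> nrm (x + y) < r.
Proof.
move=> xr yr; case: nrm_padic => _ _ _ nD _.
by apply: (le_lt_trans (nD x y)); rewrite gt_max xr yr.
Qed.

(** If [x + y] were smaller than [x], then so would be [x = (x + y) - y]. *)
Lemma padic_normD_eq x y : nrm y < nrm x -> nrm (x + y) = nrm x.
Proof.
move=> yx; apply/eqP; rewrite eq_le padic_normD_le ?(ltW yx) //= leNgt.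
apply/negP => xyx.
have := padic_normD_lt xyx (_ : nrm (- y) < nrm x).
by rewrite addrK ltxx padic_normN => /(_ yx).
Qed.

End PadicNorm.

(** * How the map changes norms *)

Section RationalMap.
Variables (R : realType) (K : fieldType) (nrm : K -> R) (p : nat).
Hypothesis nrm_padic : is_padic_norm nrm p.
Variables (a b d : K) (alpha : R).
Hypotheses (alpha_gt0 : 0 < alpha) (alpha_lt_a : alpha < nrm a).
Hypotheses (nrm_b : nrm b = alpha ^+ 2) (nrm_d : nrm d <= alpha).

Local Notation num x := (a * x ^+ 2 + b * x).
Local Notation den x := (x ^+ 2 + d * x + b).

Lemma padic_norm_den_small x : nrm x < alpha -> nrm (den x) = alpha ^+ 2.
Proof.
(* The constant term [b] dominates the other two. *)
move=> xa; rewrite addrC (padic_normD_eq nrm_padic) // nrm_b.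
have x0 := padic_norm_ge0 nrm_padic x.
have d0 := padic_norm_ge0 nrm_padic d.
apply: (padic_normD_lt nrm_padic).
  by rewrite (padic_normX nrm_padic) ltr_pXn2r // nnegrE ltW.
rewrite (padic_normM nrm_padic) expr2.
by apply: (le_lt_trans (ler_wpM2r x0 nrm_d)); rewrite ltr_pM2l.
Qed.

Lemma padic_norm_den_large x : alpha <= nrm x -> nrm (den x) <= nrm x ^+ 2.
Proof.
move=> xa; have x0 := padic_norm_ge0 nrm_padic x.
do 2?apply: (padic_normD_le nrm_padic).
- by rewrite (padic_normX nrm_padic).
- rewrite (padic_normM nrm_padic) expr2 ler_wpM2r //.
  exact: le_trans nrm_d xa.
- by rewrite nrm_b ler_pXn2r // nnegrE ltW.
Qed.

Lemma padic_norm_num x :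
  alpha ^+ 2 < nrm a * nrm x -> nrm (num x) = nrm a * nrm x ^+ 2.
Proof.
move=> xa; have x0 : 0 < nrm x.
  rewrite lt0r (padic_norm_ge0 nrm_padic) andbT.
  by apply: contraTneq xa => ->; rewrite mulr0 -leNgt sqr_ge0.
rewrite (padic_normD_eq nrm_padic) (padic_normM nrm_padic a).
  by rewrite (padic_normX nrm_padic).
rewrite (padic_normM nrm_padic b) nrm_b (padic_normX nrm_padic).
by rewrite [nrm x ^+ 2]expr2 mulrA ltr_pM2r.
Qed.

Lemma padic_norm_num_small x :
  nrm a * nrm x <= alpha ^+ 2 -> nrm (num x) <= alpha ^+ 2 * nrm x.
Proof.
move=> xa; have x0 := padic_norm_ge0 nrm_padic x.
apply: (padic_normD_le nrm_padic); rewrite (padic_normM nrm_padic).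
  by rewrite (padic_normX nrm_padic) [nrm x ^+ 2]expr2 mulrA ler_wpM2r.
by rewrite nrm_b.
Qed.

Lemma padic_norm_ratmap_preimage x y : ratmap a b d x = Some y ->
  alpha ^+ 2 < nrm a * nrm y -> nrm y <= alpha ->
  nrm a * nrm x ^+ 2 = alpha ^+ 2 * nrm y.
Proof.
rewrite /ratmap; case: eqP => // /eqP den0 [fxy] y_lb y_ub.
have eq_num : nrm (num x) = nrm y * nrm (den x).
  by rewrite -(padic_normM nrm_padic) -fxy divfK.
have y0 := padic_norm_ge0 nrm_padic y.
have x0 := padic_norm_ge0 nrm_padic x.
have [xa|xa] := ltP (nrm x) alpha; last first.
  (* Outside the open disc of radius [alpha], cancelling [nrm x ^+ 2] gives
     [nrm a <= nrm y <= alpha], which is absurd. *)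
  have x_gt0 := lt_le_trans alpha_gt0 xa.
  have ax : alpha ^+ 2 < nrm a * nrm x.
    by rewrite expr2 (lt_le_trans _ (ler_wpM2l _ xa)) ?ltr_pM2r // ?ltW //
       (lt_trans alpha_gt0).
  have := ler_wpM2l y0 (padic_norm_den_large xa).
  rewrite -eq_num padic_norm_num // ler_pM2r ?exprn_gt0 // => ay.
  by have := lt_le_trans alpha_lt_a (le_trans ay y_ub); rewrite ltxx.
move: eq_num; rewrite padic_norm_den_small // => eq_num.
have [xl|xl] := ltP (alpha ^+ 2) (nrm a * nrm x).
  by rewrite -padic_norm_num // eq_num mulrC.
(* Here [nrm y <= nrm x], so [nrm a * nrm y <= alpha ^+ 2], against the lower bound on [y]. *)
have := padic_norm_num_small xl; rewrite eq_num mulrC ler_pM2l ?exprn_gt0 //.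
have a_gt0 := lt_trans alpha_gt0 alpha_lt_a.
move=> yx; have := lt_le_trans y_lb (le_trans (ler_wpM2l (ltW a_gt0) yx) xl).
by rewrite ltxx.
Qed.

End RationalMap.

Lemma ratmap_preimage_exists (K : closedFieldType) (a b d y : K) :
  a != 0 -> b != 0 -> b + a * (a - d) != 0 -> y != a ->
  exists x, ratmap a b d x = Some y.
Proof.
move=> a0 b0 res0 ya.
have ay0 : a - y != 0 by rewrite subr_eq0 eq_sym.
(* The equation f(x) = y, cleared and divided by [a - y], expresses [x ^+ 2] through 1 and [x] with
   these coefficients. *)
have [x] := @solve_monicpoly K 2
  (fun i => if i == 0%N then y * b / (a - y) else (y * d - b) / (a - y)) isT.
rewrite big_ord_recl big_ord1 /= expr0 expr1 mulr1 => x2E.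
have fxE : a * x ^+ 2 + b * x = y * (x ^+ 2 + d * x + b).
  have : (a - y) * x ^+ 2 = y * b + (y * d - b) * x by rewrite x2E; field.
  by move=> e; apply/eqP; rewrite -subr_eq0 -(subrr ((a - y) * x ^+ 2)) {2}e;
     apply/eqP; ring.
have den0 : x ^+ 2 + d * x + b != 0.
  apply/eqP => den0; move: fxE; rewrite den0 mulr0 => num0.
  have /eqP : x * (a * x + b) = 0 by rewrite -num0; ring.
  rewrite mulf_eq0 => /orP[/eqP x0|].
    by move: den0; rewrite x0 expr0n mulr0 !add0r => /eqP; apply/negP.
  rewrite addr_eq0 => /eqP ax.
  (* At the nonzero root -b/a of the numerator, [a ^+ 2] times the denominator takes this nonzero
     value. *)
  have /eqP : b * (b + a * (a - d)) = a ^+ 2 * (x ^+ 2 + d * x + b).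
    have -> : b = - (a * x) by rewrite ax opprK.
    by ring.
  by rewrite den0 mulr0 mulf_eq0 (negbTE b0) (negbTE res0).
by exists x; rewrite /ratmap (negbTE den0) fxE mulfK.
Qed.

(** Peels off the first application of the map instead of the last, so that induction on [k] runs
    along preimages. An undefined first value stays [None] forever. *)
Lemma prepolesS (K : fieldType) (a b d xh1 xh2 : K) k x :
  prepoles a b d xh1 xh2 k.+1 x <->
  exists2 y, ratmap a b d x = Some y & prepoles a b d xh1 xh2 k y.
Proof.
rewrite /prepoles /ratmap_iter /= -!iterS !iterSr /=.
case: (ratmap a b d x) => [y|]; split.
- by move=> ?; exists y.
- by case=> _ [<-].
- have -> : iter k (obind (ratmap a b d)) None = None by elim: k => //= k ->.
  by case.
- by case.
Qed.

(** * The radii and their recurrence *)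

Section Radii.
Variables (R : realType) (alpha A : R).
Hypotheses (alpha_gt0 : 0 < alpha) (alpha_lt_A : alpha < A).

Definition prepole_radius k : R :=
  alpha * (alpha / A) `^ ((2 ^+ k - 1) / 2 ^+ k).

Lemma prepole_radius0 : prepole_radius 0 = alpha.
Proof. by rewrite /prepole_radius expr0 subrr mul0r powRr0 mulr1. Qed.

Lemma prepole_radiusS k :
  A * prepole_radius k.+1 ^+ 2 = alpha ^+ 2 * prepole_radius k.
Proof.
have A_gt0 := lt_trans alpha_gt0 alpha_lt_A.
have q_neq0 : alpha / A != 0 by rewrite gt_eqF ?divr_gt0.
rewrite /prepole_radius exprMn -[(_ `^ _) ^+ 2]powR_mulrn ?powR_ge0 // -powRrM.
(* The exponents are 1 - 2^(-k), and 2 (1 - 2^(-k-1)) = 1 + (1 - 2^(-k)). *)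
have -> : (2 ^+ k.+1 - 1) / 2 ^+ k.+1 * 2 = 1 + (2 ^+ k - 1) / 2 ^+ k :> R.
  by rewrite exprS; field; rewrite expf_neq0.
rewrite powRD ?q_neq0 ?implybT // powRr1 ?divr_ge0 ?ltW //.
by field; rewrite gt_eqF.
Qed.

Lemma prepole_radius_le k : prepole_radius k <= alpha.
Proof.
have A_gt0 := lt_trans alpha_gt0 alpha_lt_A.
have e_ge0 : 0 <= (2 ^+ k - 1) / 2 ^+ k :> R.
  by rewrite divr_ge0 ?exprn_ge0 // subr_ge0 exprn_ege1 ?ler1n.
rewrite /prepole_radius ger_pMr //.
apply: (@le_trans _ _ (1 `^ ((2 ^+ k - 1) / 2 ^+ k))); last by rewrite powR1.
apply: ge0_ler_powR => //; rewrite ?nnegrE ?divr_ge0 ?ltW //.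
by rewrite ltr_pdivrMr // mul1r.
Qed.

Lemma prepole_radius_gt0 k : 0 < prepole_radius k.
Proof.
have A_gt0 := lt_trans alpha_gt0 alpha_lt_A.
by rewrite mulr_gt0 // powR_gt0 // divr_gt0.
Qed.

(** Keeps every radius in the range where the norm of a preimage is determined. By the recurrence,
    (A r_{k+1})^2 = alpha^2 (A r_k) > alpha^4. *)
Lemma prepole_radius_gt k : alpha ^+ 2 < A * prepole_radius k.
Proof.
elim: k => [|k IHk]; first by rewrite prepole_radius0 expr2 ltr_pM2r.
have rS := prepole_radiusS k; have r0 := prepole_radius_gt0 k.+1.
have A_gt0 := lt_trans alpha_gt0 alpha_lt_A.
have h : (alpha ^+ 2) ^+ 2 < (A * prepole_radius k.+1) ^+ 2.
  rewrite [ltRHS]exprMn [A ^+ 2]expr2 -mulrA rS mulrCA expr2.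
  by rewrite ltr_pM2l ?exprn_gt0.
rewrite -(@ltr_pXn2r _ 2) // nnegrE ?sqr_ge0 //.
by rewrite mulr_ge0 // ltW.
Qed.

End Radii.

Theorem theorem4 (R : realType) (p : nat) (p_prime : prime p)
  (Cp : complex_padic R p) (a b d xh1 xh2 : Cp) (alpha beta : R)
  (ab_neq0 : a * b <> 0) (a_neq_d : a <> d)
  (poles : 'X^2 + d%:P * 'X + b%:P = ('X - xh1%:P) * ('X - xh2%:P) :> {poly Cp})
  (x2_not_pole : b + a * (a - d) <> 0)
  (def_alpha : alpha = pnorm xh1) (def_beta : beta = pnorm xh2)
  (alpha_lt_a : alpha < pnorm a) (alpha_eq_beta : alpha = beta) :
  (forall k : nat, prepoles a b d xh1 xh2 k !=set0) /\
  (forall k : nat,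
     prepoles a b d xh1 xh2 k `<=`
     psphere0 Cp (alpha * (alpha / pnorm a) `^ ((2 ^+ k - 1) / 2 ^+ k))).
Proof.
have nP := pnorm_padic Cp.
have /andP[a0 b0] : (a != 0) && (b != 0).
  by rewrite -negb_or -mulf_eq0; apply/eqP.
have dE : d = - (xh1 + xh2).
  move: (congr1 (fun P : {poly Cp} => P`_1) poles).
  rewrite mulrBl !mulrBr !(coefD, coefN, coefXM, coefMX, coefCM).
  rewrite !(coefX, coefC, coefXn) /=.
  by rewrite !(mulr0, mulr1, subr0, add0r, addr0) => ->; ring.
have bE : b = xh1 * xh2.
  move: (congr1 (horner^~ 0) poles).
  by rewrite !hornerE expr0n /= => e; rewrite -[LHS]add0r e; ring.
have nb : pnorm b = alpha ^+ 2.
  by rewrite bE (padic_normM nP) -def_alpha -def_beta -alpha_eq_beta.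
have alpha_gt0 : 0 < alpha.
  rewrite def_alpha (padic_norm_gt0 nP).
  by apply: contraNneq b0 => x0; rewrite bE x0 mul0r.
have nd : pnorm d <= alpha.
  rewrite dE (padic_normN nP); apply: (padic_normD_le nP).
    by rewrite def_alpha.
  by rewrite alpha_eq_beta def_beta.
have radius k x : prepoles a b d xh1 xh2 k x ->
    pnorm x = prepole_radius alpha (pnorm a) k.
  elim: k x => [|k IHk] x.
    rewrite prepole_radius0; case=> -[->]; first by rewrite def_alpha.
    by rewrite alpha_eq_beta.
  case/prepolesS => y fxy /IHk ny.
  have := padic_norm_ratmap_preimage nP alpha_gt0 alpha_lt_a nb nd fxy.
  rewrite ny => /(_ (prepole_radius_gt alpha_gt0 alpha_lt_a k)).
  move=> /(_ (prepole_radius_le alpha_gt0 alpha_lt_a k)).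
  (* Both [pnorm x] and the next radius solve the same equation; cancel [pnorm a] and take
     nonnegative square roots. *)
  rewrite -(prepole_radiusS alpha_gt0 alpha_lt_a).
  move=> /(mulfI (_ : pnorm a != 0)); rewrite (padic_norm_eq0 nP) => /(_ a0).
  move=> /eqP; rewrite eqrXn2 ?(padic_norm_ge0 nP) //; first by move/eqP.
  exact/ltW/prepole_radius_gt0.
split=> k; last by move=> x /radius.
elim: k => [|k [y yk]]; first by exists xh1; left.
(* Nonemptiness relies on the radii: a prepole has norm at most [alpha], hence differs from [a], the
   value at which the quadratic would degenerate. *)
have ya : y != a.
  apply: contraTneq (alpha_lt_a) => <-; rewrite -leNgt (radius _ _ yk).
  exact: (prepole_radius_le alpha_gt0 alpha_lt_a).
have [x fxy] := ratmap_preimage_exists a0 b0 (introN eqP x2_not_pole) ya.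
by exists x; apply/prepolesS; exists y.
Qed.
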